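(* Let $(m,n)$ be a coprime pair of positive integers with $m=kn\pm 1$ for some positive integer $k$. Then the sweep map $\Phi:\mathcal{D}_{m,n}\to\mathcal{D}_{m,n}$ is a bijection.
   Context: For a coprime pair $(m,n)$ of positive integers, an $(m,n)$-Dyck path is a lattice path from $(0,0)$ to $(m,n)$ with unit north steps $u=(0,1)$ and unit east steps $d=(1,0)$ that never goes below the diagonal line $y=\frac{n}{m}x$; it is encoded as a word $D=p_1p_2\cdots p_{m+n}$ with $n$ letters $u$ and $m$ letters $d$. $\mathcal{D}_{m,n}$ is the set of all such paths. Each step $p_i$ is given a rank $r_i$: $r_1=0$ and, for $2\le i\le m+n$, $r_i=r_{i-1}+m$ if $p_{i-1}=u$ and $r_i=r_{i-1}-n$ if $p_{i-1}=d$ (so $r_i$ is the value $mb-na$ at the starting point $(a,b)$ of $p_i$). These ranks are pairwise distinct. The sweep map $\Phi$ sends $D$ to the word $\Phi(D)$ obtained by rearranging the letters $p_1,\dots,p_{m+n}$ in increasing order of their ranks. It is known that $\Phi(D)\in\mathcal{D}_{m,n}$ for all $D\in\mathcal{D}_{m,n}$. *)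

(* Defs.v *)
From mathcomp Require Import all_boot all_order all_algebra.
From mathcomp Require Import zify.

Set Implicit Arguments.
Unset Strict Implicit.
Unset Printing Implicit Defensive.

Import Order.TTheory GRing.Theory Num.Theory.
Local Open Scope ring_scope.

(* Steps are booleans: the letter u = (0,1) is [true], d = (1,0) is [false]. *)
Notation north := true (only parsing).
Notation east := false (only parsing).

(* After i steps the path is at (a, b), with a the number of east steps and b
   the number of north steps among the first i; the condition n * a <= m * b
   says that this point is not below y = (n/m) x.  The region being convex, it
   is enough to test the lattice points of the path. *)
Definition is_dyck (m n : nat) (w : seq bool) : bool :=
  [&& count_mem north w == n,
      count_mem east w == m
    & [forall i : 'I_(m + n).+1,
        (n * count_mem east (take i w) <= m * count_mem north (take i w))%N]].

Definition dyck_path (m n : nat) : Type :=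
  {w : (m + n).-tuple bool | is_dyck m n w}.

Fixpoint ranks_from (m n : nat) (r : int) (w : seq bool) : seq int :=
  if w is p :: w' then
    r :: ranks_from m n (if p == north then r + m%:Z else r - n%:Z) w'
  else [::].

Definition ranks (m n : nat) (w : seq bool) : seq int := ranks_from m n 0 w.

(* The sort is by rank only, and is stable; the ranks being pairwise distinct
   for a Dyck path with coprime (m, n), ties do not occur there. *)
Definition sweep_word (m n : nat) (w : seq bool) : seq bool :=
  [seq x.2 | x <- sort (fun x y : int * bool => x.1 <= y.1)
                       (zip (ranks m n w) w)].

Section SweepDyck.
Variables m n : nat.

Let delta (b : bool) : int := if b == north then m%:Z else - n%:Z.

Lemma size_ranks_from r w : size (ranks_from m n r w) = size w.
Proof. by elim: w r => //= p w IH r; rewrite IH. Qed.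

Lemma perm_sweep_word w : perm_eq (sweep_word m n w) w.
Proof.
have {2}-> : w = [seq x.2 | x <- zip (ranks m n w) w].
  by rewrite -/(unzip2 _) unzip2_zip // size_ranks_from.
by apply: perm_map; rewrite perm_sort.
Qed.

Lemma size_sweep_word w : size (sweep_word m n w) = size w.
Proof. exact: perm_size (perm_sweep_word w). Qed.

Let sum_delta w :
  \sum_(b <- w) delta b =
  (m * count_mem north w)%N%:Z - (n * count_mem east w)%N%:Z.
Proof.
elim: w => [|b w IH]; first by rewrite big_nil !muln0.
by rewrite big_cons IH /delta; case: b => /=; nia.
Qed.

Let cut (t : int) (x : int * bool) : int :=
  Num.min (x.1 + delta x.2) t - Num.min x.1 t.

Let cut_le t x : x.1 <= t -> cut t x <= delta x.2.
Proof. by case: x => r b; rewrite /cut /=; move: (delta b) => e; lia. Qed.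

Let cut_le0 t x : t <= x.1 -> cut t x <= 0.
Proof. by case: x => r b; rewrite /cut /=; move: (delta b) => e; lia. Qed.

Let sum_cut t r w :
  \sum_(x <- zip (ranks_from m n r w) w) cut t x =
  Num.min (r + \sum_(b <- w) delta b) t - Num.min r t.
Proof.
elim: w r => [|b w IH] r /=; first by rewrite !big_nil addr0 subrr.
have -> : (if b == north then r + m%:Z else r - n%:Z) = r + delta b.
  by rewrite /delta; case: (b == north).
by rewrite !big_cons IH /cut /= addrA; lia.
Qed.

Lemma sweep_word_dyck w : is_dyck m n w -> is_dyck m n (sweep_word m n w).
Proof.
case/and3P=> /eqP hN /eqP hE _; rewrite /is_dyck.
have hp := perm_sweep_word w; have /permP hc := hp.
rewrite !hc hN hE !eqxx /=; apply/forallP=> i.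
pose le1 := fun x y : int * bool => x.1 <= y.1.
pose s := zip (ranks m n w) w; pose l := sort le1 s.
have le1_tr : transitive le1 by move=> y x z; apply: le_trans.
have le1_tot : total le1 by move=> x y; apply: le_total.
have lsort : sorted le1 l by apply: sort_sorted.
suff : 0 <= \sum_(b <- take i (sweep_word m n w)) delta b.
  by rewrite sum_delta subr_ge0 lez_nat.
have tot0 : \sum_(b <- w) delta b = 0 by rewrite sum_delta hN hE mulnC subrr.
have [hi|hi] := leqP (size l) i.
  rewrite take_oversize; last by rewrite /sweep_word size_map.
  by rewrite (perm_big _ hp) tot0.
pose t := (nth (0, true) l i).1.
have cut0 : \sum_(x <- l) cut t x = 0.
  rewrite (perm_big s) /=; last by rewrite perm_sort.
  by rewrite /s /ranks sum_cut tot0 addr0 subrr.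
have hlt x : x \in take i l -> x.1 <= t.
  move=> /(nthP (0, true)) [j]; rewrite size_take hi => ji <-.
  rewrite nth_take //.
  by apply: (sorted_ltn_nth le1_tr _ lsort) => //; rewrite inE ?(ltn_trans ji).
have hgt x : x \in drop i l -> t <= x.1.
  move=> /(nthP (0, true)) [j]; rewrite size_drop => ji <-.
  rewrite nth_drop; apply: (sorted_leq_nth le1_tr _ _ lsort) => //.
  - by move=> y; rewrite /le1.
  - by rewrite inE -ltn_subRL.
  - exact: leq_addr.
rewrite /sweep_word -map_take big_map -/l -[leLHS]cut0 -{1}(cat_take_drop i l) big_cat /=.
rewrite -[leRHS]addr0; apply: lerD.
  rewrite big_seq [leRHS]big_seq; apply: ler_sum => x /hlt.
  exact: cut_le.
rewrite big_seq; apply: sumr_le0 => x /hgt.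
exact: cut_le0.
Qed.

Lemma size_sweep_tuple (w : (m + n).-tuple bool) :
  size (sweep_word m n w) == (m + n)%N.
Proof. by rewrite size_sweep_word size_tuple. Qed.

End SweepDyck.

Definition sweep (m n : nat) (D : dyck_path m n) : dyck_path m n :=
  exist (fun w : (m + n).-tuple bool => is_dyck m n w)
        (Tuple (size_sweep_tuple (val D))) (sweep_word_dyck (valP D)).

(* Main.v *)
(* The set of Dyck paths being finite, injectivity suffices; it holds for every
   coprime pair.  Let r_0 < r_1 < ... be the sorted ranks of D, where r_i
   carries the i-th letter of the sweep word.  Because D is closed, as many
   north steps cross a given level upwards as east steps cross it downwards.
   Let r' come from another path with the same sweep word, and let r' - r be
   maximal, equal to c, at the index j.  Then r' <= s := r + c, with equality
   at j.  At the level x = s_j = r'_j the indices below and above x are the same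
   for s and r', so s has at least as many upward crossings as r' and at most
   as many downward ones; by balance the crossing steps are the same.  This
   forces s_i = r'_i at the index i of the step of D leading to s_j.  Going back
   along D we reach its first step, of index 0, where r_0 = r'_0 = 0: thus
   c = 0, and r' <= r.  By symmetry r = r', and the labelled ranks determine
   the path. *)
Require Import Defs.
From mathcomp Require Import all_boot all_order all_algebra.
From mathcomp Require Import zify.

Section SweepInjective.

Import Order.TTheory GRing.Theory Num.Theory.
Local Open Scope ring_scope.
Local Set Implicit Arguments.
Local Unset Strict Implicit.

(** * Level crossings of rank families *)

Section Crossings.
Variables (m n N : nat) (b : 'I_N -> bool).
Hypotheses (m_gt0 : (0 < m)%N) (n_gt0 : (0 < n)%N).
Implicit Types f g r : 'I_N -> int.

Definition step_delta (p : bool) : int := if p then m%:Z else - n%:Z.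

(** The level sits just below [x], separating ranks [< x] from ranks [>= x]: a north step ending at
    [x] crosses it, an east step ending at [x] does not. *)
Definition up_cross (x : int) (z : int * bool) : bool :=
  z.2 && (z.1 < x <= z.1 + m%:Z).
Definition down_cross (x : int) (z : int * bool) : bool :=
  ~~ z.2 && (z.1 - n%:Z < x <= z.1).

Definition balanced f : Prop := forall x,
  #|[pred i | up_cross x (f i, b i)]| = #|[pred i | down_cross x (f i, b i)]|.

Definition increasing f : Prop := {mono f : i j / (i <= j)%N >-> i <= j}.

Lemma balanced_shift f (c : int) : balanced f -> balanced (fun i => f i + c).
Proof.
move=> f_bal x; have := f_bal (x - c); congr (_ = _); apply: eq_card => i;
  by rewrite !inE /up_cross /down_cross /=; case: (b i) => //=; lia.
Qed.

Lemma touching_predecessor f g i j :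
    increasing f -> increasing g -> balanced f -> balanced g ->
    (forall h, g h <= f h) -> f j = g j -> f i + step_delta (b i) = f j ->
  f i = g i.
Proof.
move=> f_inc g_inc f_bal g_bal le_gf fgj fij; set x := f j in fgj fij.
have above h : (x <= f h) = (x <= g h) by rewrite {1}/x fgj f_inc g_inc.
have sub_up : [pred h | up_cross x (g h, b h)]
                \subset [pred h | up_cross x (f h, b h)].
  apply/subsetP=> h; rewrite !inE /up_cross /=.
  by move: (above h) (le_gf h); case: (b h) => //=; lia.
have sub_down : [pred h | down_cross x (f h, b h)]
                  \subset [pred h | down_cross x (g h, b h)].
  apply/subsetP=> h; rewrite !inE /down_cross /=.
  by move: (above h) (le_gf h); case: (b h) => //=; lia.
(* The two inclusions and the two balances close a cycle of inequalities, so all four cardinals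
   agree. *)
have le_up := subset_leq_card sub_up; have le_down := subset_leq_card sub_down.
have fb := f_bal x; have gb := g_bal x.
have /subset_cardP/elimT/(_ sub_up i) :
  #|[pred h | up_cross x (g h, b h)]| = #|[pred h | up_cross x (f h, b h)]|.
  by apply/eqP; rewrite eqn_leq le_up fb gb.
have /subset_cardP/elimT/(_ sub_down i) :
  #|[pred h | down_cross x (f h, b h)]| = #|[pred h | down_cross x (g h, b h)]|.
  by apply/eqP; rewrite eqn_leq le_down -fb -gb.
rewrite !inE /up_cross /down_cross /= => eq_down eq_up.
(* A north step [i] crosses upwards for [f], hence for [g]; an east step [i] does not cross for [f],
   hence not for [g]. Either way [g i < f i] is excluded. *)
move: (above i) (le_gf i) fij eq_down eq_up; rewrite /step_delta.
by case: (b i) => /=; lia.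
Qed.

End Crossings.

(** * Ranks along a path *)

Section Path.
Variables m n : nat.
Hypotheses (m_gt0 : (0 < m)%N) (n_gt0 : (0 < n)%N).
Implicit Types (r x : int) (w : seq bool).

Lemma ranks_from_cons r p w :
  ranks_from m n r (p :: w) = r :: ranks_from m n (r + step_delta m n p) w.
Proof. by case: p. Qed.

Lemma nth_ranks_from r w i : (i < size w)%N ->
  nth 0 (ranks_from m n r w) i =
  r + (m * count_mem true (take i w))%N%:Z
    - (n * count_mem false (take i w))%N%:Z.
Proof.
elim: w r i => // p w IH r [|i] iw.
  by rewrite /= !muln0 addr0 subr0.
by rewrite ranks_from_cons /= IH //; case: p {iw} => /=; lia.
Qed.

(** The truth value of [x <= rank] changes exactly at crossings, so the sum telescopes; on a closed
    path it vanishes. *)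
Lemma count_crossings r x w :
  (count (up_cross m x) (zip (ranks_from m n r w) w))%:Z
    - (count (down_cross n x) (zip (ranks_from m n r w) w))%:Z =
  (x <= r + (m * count_mem true w)%N%:Z - (n * count_mem false w)%N%:Z)%R%:Z
    - (x <= r)%R%:Z.
Proof.
elim: w r => [|p w IH] r; first by rewrite /= !muln0; lia.
rewrite ranks_from_cons /=; have := IH (r + step_delta m n p).
rewrite /up_cross /down_cross /step_delta.
by case: p => /=; lia.
Qed.

(** Backward induction along the path; [l] stays fixed while the suffix [w] shrinks. *)
Lemma rank_induction (Q : int -> Prop) (l : seq (int * bool)) r x w :
    (forall y p, (y, p) \in l -> Q (y + step_delta m n p) -> Q y) ->
    {subset zip (ranks_from m n r w) w <= l} ->
  x \in ranks_from m n r w -> Q x -> Q r.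
Proof.
move=> Q_back; elim: w r => // p w IH r; rewrite ranks_from_cons.
move=> sub_l; rewrite inE => /predU1P[-> // | xw Qx].
apply: (Q_back r p); first by apply: sub_l; rewrite /= mem_head.
by apply: IH xw Qx => z zw; apply: sub_l; rewrite /= inE zw orbT.
Qed.

(** With distinct ranks, [l] is a function from ranks to letters: the current rank dictates the next
    letter, and thereby the next rank. *)
Lemma labelled_ranks_inj r (l : seq (int * bool)) w1 w2 :
    uniq (unzip1 l) -> size w1 = size w2 ->
    {subset zip (ranks_from m n r w1) w1 <= l} ->
    {subset zip (ranks_from m n r w2) w2 <= l} ->
  w1 = w2.
Proof.
move=> l_uniq; elim: w1 w2 r => [|p1 w1 IH] [|p2 w2] r //= [eq_sz].
rewrite -!/(step_delta m n _) => sub1 sub2.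
have l_fun y q1 q2 : (y, q1) \in l -> (y, q2) \in l -> q1 = q2.
  elim: l l_uniq {IH sub1 sub2} => //= -[z q] l IHl /andP[zl /IHl{}IHl].
  have nl q' : (z, q') \notin l.
    by apply: contra zl => zl; apply/mapP; exists (z, q').
  rewrite !inE => /predU1P[[-> ->]|l1] /predU1P[[]|l2] //; last exact: IHl.
  - by rewrite (negPf (nl _)) in l2.
  - by move=> e1; rewrite e1 (negPf (nl _)) in l1.
have eq_p : p1 = p2 by apply: (l_fun r); [apply: sub1|apply: sub2]; rewrite mem_head.
subst p2; congr cons; apply: (IH _ (if p1 == true then r + m%:Z else r - n%:Z)) => //.
  by move=> z zw; apply: sub1; rewrite inE zw orbT.
by move=> z zw; apply: sub2; rewrite inE zw orbT.
Qed.

(** Equal ranks enclose a closed factor [v]. By coprimality [n] divides its number of north steps,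
    which is at most [n]; so [v] is empty or has length [m + n], but [0 < j - i < m + n]. *)
Lemma uniq_ranks w : coprime m n ->
  count_mem true w = n -> count_mem false w = m -> uniq (ranks m n w).
Proof.
move=> co_mn wn wm; apply/(uniqPn 0) => -[i [j []]].
rewrite size_ranks_from => ltij jw.
rewrite !nth_ranks_from ?(ltn_trans ltij) //.
rewrite -(subnKC (ltnW ltij)) takeD !count_cat.
set v := take _ (drop i w) => eq_r.
have sz_w : size w = (m + n)%N.
  by rewrite -(count_predC (pred1 true)) wn addnC -wm; congr addn; apply: eq_count; case.
have sz_v : size v = (j - i)%N by rewrite size_take size_drop; case: ltnP; lia.
have sz_count : (count_mem true v + count_mem false v)%N = (j - i)%N.
  by rewrite -sz_v -(count_predC (pred1 true)); congr addn; apply: eq_count; case.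
have le_v q : (count_mem q v <= count_mem q w)%N.
  rewrite -(cat_take_drop i w) -(cat_take_drop (j - i) (drop i w)) !count_cat.
  by rewrite -/v; lia.
have := le_v true; have := le_v false; rewrite wn wm.
have eq_v : (m * count_mem true v = n * count_mem false v)%N by nia.
have : (n %| count_mem true v)%N.
  by rewrite -(Gauss_dvdr _ (_ : coprime n m)) 1?coprime_sym // eq_v dvdn_mulr.
case/dvdnP=> -[|[|q]] q_def; rewrite q_def in eq_v sz_count *; nia.
Qed.

End Path.

(** * Sorted ranks of one Dyck path *)

Section SweptRanks.
Variables m n : nat.
Hypotheses (m_gt0 : (0 < m)%N) (n_gt0 : (0 < n)%N) (co_mn : coprime m n).

Definition swept_steps (w : seq bool) : seq (int * bool) :=
  sort (fun x y : int * bool => x.1 <= y.1) (zip (ranks m n w) w).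

Definition swept_rank (w : seq bool) (i : 'I_(m + n)) : int :=
  (nth (0, true) (swept_steps w) i).1.

Definition swept_letter (w : seq bool) (i : 'I_(m + n)) : bool :=
  nth true (sweep_word m n w) i.

Variable w : seq bool.
Hypotheses (sz_w : size w = (m + n)%N) (dyck_w : is_dyck m n w).

Lemma mem_swept_steps z :
  (z \in swept_steps w) = (z \in zip (ranks m n w) w).
Proof. by rewrite mem_sort. Qed.

Lemma size_swept_steps : size (swept_steps w) = (m + n)%N.
Proof. by rewrite size_sort size_zip size_ranks_from minnn. Qed.

Lemma swept_step_nth (i : 'I_(m + n)) :
  nth (0, true) (swept_steps w) i = (swept_rank w i, swept_letter w i).
Proof.
rewrite /swept_letter /sweep_word (nth_map (0, true)) ?size_swept_steps //.
exact: surjective_pairing.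
Qed.

Lemma swept_stepP z :
  z \in swept_steps w -> exists i : 'I_(m + n), z = (swept_rank w i, swept_letter w i).
Proof.
move=> /(nthP (0, true)) [i]; rewrite size_swept_steps => lti <-.
by exists (Ordinal lti); rewrite -swept_step_nth.
Qed.

Lemma perm_swept_ranks : perm_eq (unzip1 (swept_steps w)) (ranks m n w).
Proof.
rewrite -[X in perm_eq _ X](@unzip1_zip _ _ _ w) ?size_ranks_from //.
by apply: perm_map; rewrite perm_sort.
Qed.

Lemma uniq_swept_ranks : uniq (unzip1 (swept_steps w)).
Proof.
rewrite (perm_uniq perm_swept_ranks).
by case/and3P: dyck_w => /eqP wn /eqP wm _; apply: uniq_ranks.
Qed.

Lemma swept_rank_increasing : increasing (swept_rank w).
Proof.
have sz := size_swept_steps.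
have : sorted <%R (unzip1 (swept_steps w)).
  rewrite lt_sorted_uniq_le uniq_swept_ranks sorted_map.
  by apply: sort_sorted => x y; apply: le_total.
move=> srt i j; rewrite /swept_rank -!(nth_map _ 0 fst) ?sz //.
by rewrite -/(unzip1 _) (lt_sorted_leq_nth _ srt) ?inE ?size_map ?sz.
Qed.

Lemma card_swept (P : pred (int * bool)) :
  #|[pred i : 'I_(m + n) | P (swept_rank w i, swept_letter w i)]| =
  count P (zip (ranks m n w) w).
Proof.
have /permP <- : perm_eq (swept_steps w) (zip (ranks m n w) w) by rewrite perm_sort.
rewrite -sum1_card -sum1_count (big_nth (0, true)) size_swept_steps big_mkord.
by apply: eq_bigl => i; rewrite inE swept_step_nth.
Qed.

Lemma swept_rank_balanced : balanced m n (swept_letter w) (swept_rank w).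
Proof.
case/and3P: dyck_w => /eqP wn /eqP wm _ x; rewrite !card_swept.
have := count_crossings m_gt0 n_gt0 0 x w.
by rewrite wn wm mulnC add0r subrr subrr => /subr0_eq [].
Qed.

(** Staying above the diagonal makes all ranks nonnegative, and the starting point has rank 0. *)
Lemma swept_rank0 (i : 'I_(m + n)) : i = 0%N :> nat -> swept_rank w i = 0.
Proof.
move=> i0; case/and3P: dyck_w => wn wm /forallP above.
have w_pos : (0 < size w)%N by rewrite sz_w ltn_addr.
have ranks_ge0 x : x \in ranks m n w -> 0 <= x.
  move=> /(nthP 0) [j]; rewrite size_ranks_from => ltj <-.
  rewrite nth_ranks_from // add0r subr_ge0 lez_nat.
  have ltj' : (j < (m + n).+1)%N by rewrite -sz_w ltnW.
  exact: (above (Ordinal ltj')).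
have rank_in h : swept_rank w h \in ranks m n w.
  rewrite -(perm_mem perm_swept_ranks); apply: map_f; apply: mem_nth.
  by rewrite size_swept_steps.
have : 0 \in unzip1 (swept_steps w).
  by rewrite (perm_mem perm_swept_ranks) /ranks; case: (w) w_pos => //= *; apply: mem_head.
case/mapP=> z /swept_stepP[j ->] /= j0.
apply/eqP; rewrite eq_le ranks_ge0 // andbT [leRHS]j0 swept_rank_increasing.
by rewrite i0.
Qed.

End SweptRanks.

(** * Comparison of two paths with the same sweep word *)

Section TwoPaths.
Variables m n : nat.
Hypotheses (m_gt0 : (0 < m)%N) (n_gt0 : (0 < n)%N) (co_mn : coprime m n).

Lemma swept_rank_le w1 w2 :
    size w1 = (m + n)%N -> size w2 = (m + n)%N ->
    is_dyck m n w1 -> is_dyck m n w2 -> sweep_word m n w1 = sweep_word m n w2 ->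
  forall i : 'I_(m + n), swept_rank w2 i <= swept_rank w1 i.
Proof.
move=> sz1 sz2 dyck1 dyck2 eq_sw.
have eq_let : swept_letter w2 = swept_letter w1 :> ('I_(m + n) -> bool).
  by rewrite /swept_letter eq_sw.
have mn_gt0 : (0 < m + n)%N by rewrite ltn_addr.
pose gap (i : 'I_(m + n)) := swept_rank w2 i - swept_rank w1 i.
have [j _ gap_max] := @arg_maxP _ _ _ (Ordinal mn_gt0) xpredT gap isT.
have inc1 := swept_rank_increasing m_gt0 n_gt0 co_mn sz1 dyck1.
have inc2 := swept_rank_increasing m_gt0 n_gt0 co_mn sz2 dyck2.
have bal1 := swept_rank_balanced m_gt0 n_gt0 sz1 dyck1.
have bal2 := swept_rank_balanced m_gt0 n_gt0 sz2 dyck2.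
(* [Q y]: the maximal gap is attained at the rank [y] of the first path. It is carried back from the
   rank of index [j] to rank 0. *)
pose Q y := exists2 i : 'I_(m + n), swept_rank w1 i = y & gap i = gap j.
have Q_back y p : (y, p) \in swept_steps m n w1 -> Q (y + step_delta m n p) -> Q y.
  case/(swept_stepP sz1)=> i [-> ->] [h rk_h gap_h]; exists i => //.
  suff : swept_rank w1 i + gap j = swept_rank w2 i by rewrite {2}/gap; lia.
  apply: (@touching_predecessor m n _ (swept_letter w1) m_gt0 n_gt0
            (fun i => swept_rank w1 i + gap j) (swept_rank w2) i h) => //.
  - by move=> i1 i2; rewrite lerD2r inc1.
  - exact: balanced_shift.
  - by rewrite -eq_let.
  - by move=> i1; rewrite -lerBlDl; apply: gap_max.
  - by rewrite -gap_h /gap; lia.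
  - by rewrite rk_h; lia.
have [i i0 gap_i] : Q 0.
  apply: (@rank_induction m n Q (swept_steps m n w1) 0 (swept_rank w1 j) w1 Q_back).
  - by move=> z; rewrite mem_swept_steps.
  - rewrite -(perm_mem (perm_swept_ranks m n w1)); apply: map_f; apply: mem_nth.
    by rewrite size_swept_steps.
  - by exists j.
have i_0 : i = 0%N :> nat.
  apply/eqP; rewrite -leqn0 -[0%N]/(val (Ordinal mn_gt0)) -inc1 i0.
  by rewrite (swept_rank0 m_gt0 n_gt0 co_mn sz1).
move=> h; have := gap_max h isT; rewrite -gap_i /gap.
rewrite (swept_rank0 m_gt0 n_gt0 co_mn sz2 dyck2 i_0) i0; lia.
Qed.

Lemma sweep_word_inj w1 w2 :
    size w1 = (m + n)%N -> size w2 = (m + n)%N ->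
    is_dyck m n w1 -> is_dyck m n w2 -> sweep_word m n w1 = sweep_word m n w2 ->
  w1 = w2.
Proof.
move=> sz1 sz2 dyck1 dyck2 eq_sw.
have eq_steps : swept_steps m n w1 = swept_steps m n w2.
  have sz := size_swept_steps.
  apply: (eq_from_nth (x0 := (0, true))) => [|i]; rewrite !sz // => lti.
  rewrite -[i]/(val (Ordinal lti)) !swept_step_nth // /swept_letter eq_sw.
  by congr pair; apply/le_anti; rewrite !swept_rank_le.
apply: (@labelled_ranks_inj m n 0 (swept_steps m n w1)).
- exact: uniq_swept_ranks.
- by rewrite sz1.
- by move=> z; rewrite mem_swept_steps.
- by move=> z; rewrite eq_steps mem_swept_steps.
Qed.

End TwoPaths.

End SweepInjective.

Theorem theorem3 (m n k : nat) (m_gt0 : 0 < m) (n_gt0 : 0 < n)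
    (co_mn : coprime m n) (k_gt0 : 0 < k)
    (m_eq : m = k * n + 1 \/ m = k * n - 1) :
  bijective (@sweep m n).
Proof.
(* As a subtype of tuples the Dyck paths form a finite type. *)
apply: (@injF_bij {w : (m + n).-tuple bool | is_dyck m n w}) => D1 D2 eq_D.
apply/val_inj/val_inj.
apply: (sweep_word_inj m_gt0 n_gt0 co_mn); rewrite ?size_tuple ?(valP D1) ?(valP D2) //.
by move/(congr1 (fun D : dyck_path m n => tval (val D))): eq_D.
Qed.
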